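(* Let $X$ and $Y$ be complex topological vector spaces, and assume that $\Gamma\subset\mathcal{B}(X)$ and $\Gamma_1\subset\mathcal{B}(Y)$ are quasi-similar. If $\Gamma$ is disk transitive in $X$, then $\Gamma_1$ is disk transitive in $Y$.
   Context: $\mathcal{B}(X)$ is the set of all continuous linear operators on $X$, and $\mathbb{D}=\{\alpha\in\mathbb{C}:|\alpha|\le 1\}$. $\Gamma$ and $\Gamma_1$ are called quasi-similar if there exists a continuous linear operator $\phi:X\to Y$ with dense range such that for all $T\in\Gamma$ there exists $S\in\Gamma_1$ satisfying $S\circ\phi=\phi\circ T$. A set $\Gamma\subset\mathcal{B}(X)$ is disk transitive if for any pair $(U,V)$ of nonempty open subsets of $X$ there exist $\alpha\in\mathbb{D}\setminus\{0\}$ and $T\in\Gamma$ such that $T(\alpha U)\cap V\neq\emptyset$ (similarly on $Y$). *)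

(* Defs.v *)
From HB Require Import structures.
From mathcomp Require Import all_boot all_order all_algebra.
From mathcomp Require Import all_classical reals topology tvs.
From mathcomp Require Import complex.

Set Implicit Arguments.
Unset Strict Implicit.
Unset Printing Implicit Defensive.

Import Order.TTheory GRing.Theory Num.Theory.

Local Open Scope classical_set_scope.
Local Open Scope ring_scope.
Local Open Scope complex_scope.

(* [topologicalLmodType R[i]] is a topological vector space over R[i]
   (neither Hausdorff nor locally convex in general), the scalars carrying the
   topology of the complex modulus. *)
Definition continuous_operators (R : realType) (X : topologicalLmodType R[i]) :
  set {linear X -> X} := [set T : {linear X -> X} | continuous T].
Arguments continuous_operators {R} X.

(* The order of R[i] only relates numbers with the same imaginary part and
   the modulus is valued in R[i], so this is the closed unit disk. *)
Definition unit_disk (R : realType) : set R[i] :=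
  [set alpha : R[i] | `|alpha| <= 1].
Arguments unit_disk R : clear implicits.

Definition quasi_similar (R : realType) (X Y : topologicalLmodType R[i])
    (Gamma : set {linear X -> X}) (Gamma1 : set {linear Y -> Y}) : Prop :=
  exists phi : {linear X -> Y},
    [/\ continuous phi, dense (range phi) &
        forall T : {linear X -> X}, Gamma T ->
          exists2 S : {linear Y -> Y}, Gamma1 S & S \o phi = phi \o T].

Definition disk_transitive (R : realType) (X : topologicalLmodType R[i])
    (Gamma : set {linear X -> X}) : Prop :=
  forall U V : set X, open U -> U !=set0 -> open V -> V !=set0 ->
    exists alpha : R[i], exists T : {linear X -> X},
      [/\ (unit_disk R `\ 0) alpha, Gamma T &
          (T @` [set alpha *: x | x in U]) `&` V !=set0].

(* Main.v *)
Require Import Defs.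
From HB Require Import structures.
From mathcomp Require Import all_boot all_order all_algebra.
From mathcomp Require Import all_classical reals topology tvs.
From mathcomp Require Import complex.

Local Open Scope classical_set_scope.
Local Open Scope ring_scope.
Local Open Scope complex_scope.

(** Disk transitivity is transported along the intertwining map [phi]. Nonempty open sets [U], [V]
    of [Y] pull back to sets that are open by continuity and nonempty because the range of [phi] is
    dense ([preimage_dense_range_neq0]). Transitivity in [X] then gives [alpha], [T] and [x] with
    [phi x] in [U] and [phi (T (alpha *: x))] in [V]; an [S] intertwined with [T] satisfies the
    required condition with the same [alpha]. *)

Lemma preimage_dense_range_neq0 (T U : topologicalType) (f : T -> U) (A : set U) :
  dense (range f) -> open A -> A !=set0 -> f @^-1` A !=set0.
Proof. by move=> fd Ao A0; have [y [Ay [x _ fxy]]] := fd A A0 Ao; exists x; rewrite /= fxy. Qed.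

Theorem proposition3p3 (R : realType) (X Y : topologicalLmodType R[i])
    (Gamma : set {linear X -> X}) (Gamma1 : set {linear Y -> Y})
    (Gamma_cont : Gamma `<=` continuous_operators X)
    (Gamma1_cont : Gamma1 `<=` continuous_operators Y)
    (Gamma_Gamma1 : quasi_similar Gamma Gamma1) :
  disk_transitive Gamma -> disk_transitive Gamma1.
Proof.
case: Gamma_Gamma1 => phi [phi_cont phi_dense phi_sim] Gamma_trans U V Uo U0 Vo V0.
have phi_open (A : set Y) : open A -> open (phi @^-1` A).
  by apply: open_comp => x _; exact: phi_cont.
have [alpha [T [alphaD GT [_ [[_ [x Ux <-] <-] Vx]]]]] :=
  Gamma_trans _ _ (phi_open _ Uo) (preimage_dense_range_neq0 _ _ _ _ phi_dense Uo U0)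
    (phi_open _ Vo) (preimage_dense_range_neq0 _ _ _ _ phi_dense Vo V0).
have [S G1S S_phi] := phi_sim T GT.
(* The image under [phi] of the meeting point found in [X] is the meeting point in [Y]. *)
exists alpha, S; split=> //; exists (phi (T (alpha *: x))); split=> //.
exists (alpha *: phi x); first by exists (phi x).
(* Linearity of [phi] moves [alpha] inside, so that [S \o phi = phi \o T] applies at
   [alpha *: x]. *)
by rewrite -GRing.linearZ; exact: (congr1 (@^~ (alpha *: x)) S_phi).
Qed.
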